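(* For every 3-hypergraph $\mathbb{H}$, there exists a 3-uniform 3-hypergraph $\mathbb{H}'$ such that $\mathbf{V}(S_{\mathbb{H}})=\mathbf{V}(S_{\mathbb{H}'})$.
   Context: A hypergraph $\mathbb{H}=(V,E)$ consists of a finite set $V$ of vertices and a set $E$ of subsets of $V$ (hyperedges). A 3-hypergraph is a hypergraph whose largest hyperedge has exactly 3 elements and which satisfies the following standing assumptions: it is finite; it is linear (any two distinct hyperedges share at most one vertex); every vertex lies in some hyperedge; every hyperedge has at least 2 elements; and every hyperedge with exactly 2 elements is disjoint from all other hyperedges. It is 3-uniform if every hyperedge has exactly 3 elements. A subhyperedge is a nonempty subset of a hyperedge. Two subhyperedges $e_1',e_2'$ are linked if there is a single vertex $w\notin e_1'\cup e_2'$ such that $e_1'\cup\{w\}$ and $e_2'\cup\{w\}$ are both hyperedges. The 3-hypergraph semigroup $SG_{\mathbb{H}}$ is the semigroup given by the presentation with generators $\mathbf{a}_u$ ($u\in V$) and $0$, and relations: $\mathbf{a}_u\mathbf{a}_v=\mathbf{a}_v\mathbf{a}_u$; $0\mathbf{a}_u=\mathbf{a}_u0=00=0$; $\mathbf{a}_u\mathbf{a}_v=0$ if $u=v$ or $\{u,v\}$ is not a subhyperedge; $\mathbf{a}_u\mathbf{a}_v\mathbf{a}_h=0$ if $\{u,v,h\}\notin E$; $\mathbf{a}_{u_i}\mathbf{a}_{u_j}=\mathbf{a}_{u_r}\mathbf{a}_{u_l}$ if $\{u_i,u_j\}$ and $\{u_r,u_l\}$ are linked; and for every hyperedge $\{u_1,\dots,u_k\}$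 (of $k$ elements), $\mathbf{a}_{u_1}\cdots\mathbf{a}_{u_k}=\mathbf{a}$, where $\mathbf{a}$ is one and the same (nonzero) element for all hyperedges. This semigroup with zero is 0-cancellative ($xy=xz\neq0\Rightarrow y=z$ and dually), and therefore becomes a semiring $S_{\mathbb{H}}$, called the 3-hypergraph semiring of $\mathbb{H}$, under the flat addition $x+x=x$ and $x+y=0$ for $x\ne y$. $\mathbf{V}(S)$ denotes the variety generated by the semiring $S$, in the signature $\{+,\cdot\}$ (both operations associative, $+$ commutative, $\cdot$ distributing over $+$ on both sides). *)

(* Defs.v *)
From HB Require Import structures.
From mathcomp Require Import all_boot.
From mathcomp Require Import boolp.

Set Implicit Arguments.
Unset Strict Implicit.
Unset Printing Implicit Defensive.

Local Open Scope quotient_scope.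

(* No neutral elements are part of the signature, so the MathComp semirings,
   which have 0 and 1, do not apply.  As usual in universal algebra, carriers
   are nonempty. *)
Record semiring := Semiring {
  sr_car :> Type;
  sr_add : sr_car -> sr_car -> sr_car;
  sr_mul : sr_car -> sr_car -> sr_car;
  sr_inhabited : inhabited sr_car;
  sr_addA : associative sr_add;
  sr_addC : commutative sr_add;
  sr_mulA : associative sr_mul;
  sr_mulDl : left_distributive sr_mul sr_add;
  sr_mulDr : right_distributive sr_mul sr_add
}.

Definition is_hom (A B : semiring) (f : A -> B) : Prop :=
  {morph f : x y / sr_add x y >-> sr_add x y} /\
  {morph f : x y / sr_mul x y >-> sr_mul x y}.

Section Product.
Variables (I : Type) (F : I -> semiring).

Let car := forall i, F i.
Let add (f g : car) : car := fun i => sr_add (f i) (g i).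
Let mul (f g : car) : car := fun i => sr_mul (f i) (g i).

Fact prod_inhabited : inhabited car.
Proof.
have h i : {x : F i | True}.
  by apply: constructive_indefinite_description; case: (sr_inhabited (F i)) => x; exists x.
by apply: inhabits => i; case: (h i).
Qed.
Fact prod_addA : associative add.
Proof. by move=> f g h; apply: functional_extensionality_dep => i; apply: sr_addA. Qed.
Fact prod_addC : commutative add.
Proof. by move=> f g; apply: functional_extensionality_dep => i; apply: sr_addC. Qed.
Fact prod_mulA : associative mul.
Proof. by move=> f g h; apply: functional_extensionality_dep => i; apply: sr_mulA. Qed.
Fact prod_mulDl : left_distributive mul add.
Proof. by move=> f g h; apply: functional_extensionality_dep => i; apply: sr_mulDl. Qed.
Fact prod_mulDr : right_distributive mul add.
Proof. by move=> f g h; apply: functional_extensionality_dep => i; apply: sr_mulDr. Qed.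

Definition prod_semiring : semiring :=
  Semiring prod_inhabited prod_addA prod_addC prod_mulA prod_mulDl prod_mulDr.
End Product.

(* Subalgebras are given up to isomorphism, as domains of injective
   homomorphisms. *)
Definition is_variety (K : semiring -> Prop) : Prop :=
  [/\ forall (A B : semiring) (f : A -> B),
        is_hom f -> (forall y, exists x, f x = y) -> K A -> K B,
      forall (A B : semiring) (f : B -> A),
        is_hom f -> injective f -> K A -> K B &
      forall (I : Type) (F : I -> semiring),
        (forall i, K (F i)) -> K (prod_semiring F)].

(* The variety generated by S, i.e. the smallest variety containing S, as a
   class of semirings. *)
Definition variety (S : semiring) : semiring -> Prop :=
  fun A => forall K : semiring -> Prop, is_variety K -> K S -> K A.

Record hypergraph3 := Hypergraph3 {
  vertex : finType;
  hedges : {set {set vertex}};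
  hedges_rank : \max_(e in hedges) #|e| = 3;
  hedges_linear : forall e f : {set vertex},
    e \in hedges -> f \in hedges -> e != f -> #|e :&: f| <= 1;
  hedges_cover : forall u : vertex, exists2 e, e \in hedges & u \in e;
  hedges_ge2 : forall e : {set vertex}, e \in hedges -> 2 <= #|e|;
  hedges_isol2 : forall e f : {set vertex},
    e \in hedges -> f \in hedges -> #|e| = 2 -> f != e -> [disjoint e & f]
}.

Definition uniform3 (H : hypergraph3) : Prop :=
  forall e : {set vertex H}, e \in hedges H -> #|e| = 3.

Definition subhyperedge (H : hypergraph3) (e' : {set vertex H}) : bool :=
  (e' != set0) && [exists e in hedges H, e' \subset e].

Definition linked (H : hypergraph3) (e1 e2 : {set vertex H}) : bool :=
  [&& subhyperedge e1, subhyperedge e2 &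
      [exists w, [&& w \notin e1 :|: e2, w |: e1 \in hedges H & w |: e2 \in hedges H]]].

(* The free semigroup on the generators 0 (= None) and a_u (= Some u): the pair
   (g, s) stands for the nonempty word g :: s. *)
Definition word (H : hypergraph3) : Type :=
  (option (vertex H) * seq (option (vertex H)))%type.
HB.instance Definition _ (H : hypergraph3) := Choice.on (word H).

Definition wmul (H : hypergraph3) (x y : word H) : word H :=
  (x.1, x.2 ++ y.1 :: y.2).
Definition w0 (H : hypergraph3) : word H := (None, [::]).
Definition wgen (H : hypergraph3) (u : vertex H) : word H := (Some u, [::]).
(* a_u1 a_u2 ... a_uk, for s = [:: u2; ...; uk] *)
Definition wprod (H : hypergraph3) (u1 : vertex H) (s : seq (vertex H)) : word H :=
  (Some u1, map Some s).

Declare Scope word_scope.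
Delimit Scope word_scope with W.
Bind Scope word_scope with word.
Local Notation "x * y" := (wmul x%W y%W) : word_scope.
Local Notation "0" := (w0 _) : word_scope.
Local Notation "''a_' u" := (wgen u) (at level 8, u at level 2) : word_scope.

Inductive sg_rel (H : hypergraph3) : word H -> word H -> Prop :=
| rel_comm u v : sg_rel ('a_u * 'a_v)%W ('a_v * 'a_u)%W
| rel_0gen u : sg_rel (0 * 'a_u)%W 0%W
| rel_gen0 u : sg_rel ('a_u * 0)%W 0%W
| rel_00 : sg_rel (0 * 0)%W 0%W
| rel_pair u v : u = v \/ ~~ subhyperedge [set u; v] -> sg_rel ('a_u * 'a_v)%W 0%W
| rel_triple u v h : [set u; v; h] \notin hedges H ->
    sg_rel ('a_u * 'a_v * 'a_h)%W 0%W
| rel_linked u v r l : linked [set u; v] [set r; l] ->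
    sg_rel ('a_u * 'a_v)%W ('a_r * 'a_l)%W
(* the products over any two hyperedges coincide: their common value is the
   element called a *)
| rel_edge u s v t :
    uniq (u :: s) -> [set:: u :: s] \in hedges H ->
    uniq (v :: t) -> [set:: v :: t] \in hedges H ->
    sg_rel (wprod u s) (wprod v t).

Inductive sg_cong (H : hypergraph3) : word H -> word H -> Prop :=
| cong_rel x y : sg_rel x y -> sg_cong x y
| cong_refl x : sg_cong x x
| cong_sym x y : sg_cong x y -> sg_cong y x
| cong_trans x y z : sg_cong x y -> sg_cong y z -> sg_cong x z
| cong_mul x x' y y' : sg_cong x x' -> sg_cong y y' -> sg_cong (x * y)%W (x' * y')%W.

Lemma sg_cong_is_equiv (H : hypergraph3) :
  equiv_class_of (fun x y : word H => `[< sg_cong x y >]).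
Proof.
split=> [x|x y|y x z].
- by apply/asboolP; apply: cong_refl.
- by apply/asboolP/asboolP; apply: cong_sym.
- by move=> /asboolP xy /asboolP yz; apply/asboolP; apply: cong_trans xy yz.
Qed.

Canonical sg_cong_equiv (H : hypergraph3) : equiv_rel (word H) :=
  EquivRelPack (sg_cong_is_equiv H).

Definition hypergraph_semigroup (H : hypergraph3) : Type := {eq_quot (sg_cong_equiv H)}.
HB.instance Definition _ (H : hypergraph3) := Choice.on (hypergraph_semigroup H).
HB.instance Definition _ (H : hypergraph3) := Quotient.on (hypergraph_semigroup H).

Definition sg_mul (H : hypergraph3) :
    hypergraph_semigroup H -> hypergraph_semigroup H -> hypergraph_semigroup H :=
  lift_op2 (hypergraph_semigroup H) (@wmul H).
Definition sg0 (H : hypergraph3) : hypergraph_semigroup H := \pi_(hypergraph_semigroup H) (w0 H).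
Definition flat_add (H : hypergraph3) (x y : hypergraph_semigroup H) :
    hypergraph_semigroup H :=
  if x == y then x else sg0 H.

Section SG.
Variable H : hypergraph3.
Local Notation V := (vertex H).
Local Notation E := (hedges H).
Local Notation "x ~~> y" := (@sg_cong H x%W y%W) (at level 70).
Implicit Types (u v w r l p q : V) (e f : {set V}) (x y z : word H).

Definition tri u v w : bool := [&& u != v, v != w, u != w & [set u; v; w] \in E].

Lemma tri_edge u v w : tri u v w -> [set u; v; w] \in E.
Proof. by case/and4P. Qed.

Lemma tri_sym12 u v w : tri u v w = tri v u w.
Proof.
rewrite /tri (eq_sym u v) [[set u; v; w]](_ : _ = [set v; u; w]); last by rewrite [u |: _]setUC.
by case: (v == u); case: (v == w); case: (u == w).
Qed.

Lemma tri_sym23 u v w : tri u v w = tri u w v.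
Proof.
rewrite /tri (eq_sym v w) [[set u; v; w]](_ : _ = [set u; w; v]); last by rewrite setUAC.
by case: (u == v); case: (w == v); case: (u == w).
Qed.

Lemma edge_inj e f u v : e \in E -> f \in E -> u != v ->
  u \in e -> v \in e -> u \in f -> v \in f -> e = f.
Proof.
move=> eE fE uv ue ve uf vf; apply/eqP; apply: contraT => ef.
have := hedges_linear eE fE ef; rewrite leqNgt => /negP[].
have <- : #|[set u; v]| = 2 by rewrite cards2 uv.
by apply: subset_leq_card; apply/subsetP => t /set2P[->|->]; rewrite inE ?ue ?ve.
Qed.

Lemma tri_inj u v w w' : tri u v w -> tri u v w' -> w = w'.
Proof.
move=> /and4P[uv vw uw e1] /and4P[_ _ _ e2].
have e12 : [set u; v; w] = [set u; v; w'].
  by apply: (edge_inj e1 e2 uv); rewrite !inE eqxx ?orbT.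
have : w \in [set u; v; w'] by rewrite -e12 !inE eqxx !orbT.
by rewrite !inE (eq_sym w u) (eq_sym w v) (negPf uw) (negPf vw) => /eqP.
Qed.

Lemma duo_isol u v e t : u != v -> [set u; v] \in E -> e \in E ->
  t \in e -> t \in [set u; v] -> e = [set u; v].
Proof.
move=> uv uvE eE te tuv; apply/eqP; apply: contraT => ne.
have c2 : #|[set u; v]| = 2 by rewrite cards2 uv.
by have /pred0P/(_ t) := hedges_isol2 uvE eE c2 ne; rewrite /= te tuv.
Qed.

Lemma card_edge e : e \in E -> #|e| <= 3.
Proof. by move=> eE; rewrite -(hedges_rank H) (bigmax_sup e). Qed.

Lemma card_tri u v w : tri u v w -> #|[set u; v; w]| = 3.
Proof.
case/and4P=> uv vw uw _; rewrite setUC cardsU1 cards2 uv !inE.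
by rewrite (eq_sym w u) (eq_sym w v) (negPf uw) (negPf vw).
Qed.

Lemma duo_tri u v t r w : u != v -> [set u; v] \in E -> tri t r w -> t != u.
Proof.
move=> uv uvE trw; apply/negP => /eqP tu.
have e12 : [set t; r; w] = [set u; v].
  by apply: (duo_isol uv uvE (tri_edge trw) (t := u)); rewrite !inE ?tu eqxx.
by have := card_tri trw; rewrite e12 cards2 uv.
Qed.

Lemma subhedge_pair u v : u != v -> subhyperedge [set u; v] ->
  [set u; v] \in E \/ exists w, tri u v w.
Proof.
move=> uv /andP[_ /exists_inP[e eE uve]].
have c2 : #|[set u; v]| = 2 by rewrite cards2 uv.
have [<-|ne] := eqVneq e [set u; v]; first by left.
have /properP[_ [w we wuv]] : [set u; v] \proper e.
  by rewrite properEneq eq_sym ne.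
right; exists w; move: wuv; rewrite !inE negb_or => /andP[wu wv].
rewrite /tri uv (eq_sym v) (eq_sym u w) wu wv /=.
suff -> : [set u; v; w] = e by [].
apply/eqP; rewrite eqEcard; apply/andP; split.
  by rewrite subUset uve sub1set.
apply: leq_trans (card_edge eE) _.
rewrite setUC cardsU1 cards2 uv !inE (negPf wu) (negPf wv) //.
Qed.

Lemma subhedge_edge e' e : e' != set0 -> e \in E -> e' \subset e -> subhyperedge e'.
Proof. by move=> e0 eE se; rewrite /subhyperedge e0; apply/exists_inP; exists e. Qed.

Lemma set2_neq0 u v : [set u; v] != set0.
Proof. by apply/set0Pn; exists u; rewrite !inE eqxx. Qed.

Lemma tri_subhedge u v w : tri u v w -> subhyperedge [set u; v].
Proof. by move=> /tri_edge tE; apply: (subhedge_edge (set2_neq0 u v) tE); apply: subsetUl. Qed.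

(* Normal forms: NE is the empty word, NP w is the value of a_p a_q for a
   hyperedge {p, q, w} of 3 elements, and NT is the element a. *)
Inductive nf := NE | NZ | NT | NV of V | NP of V.

Definition has3 w : bool := [exists p, exists q, tri p q w].

Definition step (n : nf) (g : option V) : nf :=
  match n, g with
  | NE, Some u => NV u
  | NV u, Some v =>
      if (u != v) && ([set u; v] \in E) then NT
      else if [pick w | tri u v w] is Some w then NP w else NZ
  | NP w, Some v => if (w == v) && has3 w then NT else NZ
  | _, _ => NZ
  end.

Definition run (n : nf) x : nf := foldl step n (x.1 :: x.2).

Lemma run_mul n x y : run n (x * y)%W = run (run n x) y.
Proof. by rewrite /run /= foldl_cat. Qed.

Lemma stepNone n : step n None = NZ. Proof. by case: n. Qed.

Lemma run_w0 n : run n 0%W = NZ. Proof. exact: stepNone. Qed.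

Lemma run_NZ x : run NZ x = NZ.
Proof. by case: x => g s; rewrite /run /=; elim: s. Qed.

Lemma step_tri u v w : tri u v w -> step (NV u) (Some v) = NP w.
Proof.
move=> t /=; case: ifP => [/andP[uv uvE]|_].
  by have := duo_tri uv uvE t; rewrite eqxx.
by case: pickP => [w' /(tri_inj t) ->|/(_ w)] //; rewrite t.
Qed.

Variant step_spec u v : nf -> Prop :=
| StepDuo of u != v & [set u; v] \in E : step_spec u v NT
| StepTri w of tri u v w : step_spec u v (NP w)
| StepNo of (u == v) || ~~ subhyperedge [set u; v] : step_spec u v NZ.

Lemma stepP u v : step_spec u v (step (NV u) (Some v)).
Proof.
rewrite /=; case: ifP => [/andP[uv uvE]|/negbT nd]; first exact: StepDuo.
case: pickP => [w|no]; first exact: StepTri.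
apply: StepNo; case: eqVneq nd => //= uv nd; apply/negP.
case/(subhedge_pair uv) => [uvE|[w]]; last by rewrite no.
by rewrite uvE in nd.
Qed.

Lemma step_sym u v : step (NV u) (Some v) = step (NV v) (Some u).
Proof.
rewrite /= eq_sym [[set u; v]]setUC; case: ifP => // _.
by rewrite (eq_pick (Q := fun w => tri v u w)) // => w; rewrite /= tri_sym12.
Qed.

Lemma step2_NV r u v :
  step (step (NV r) (Some u)) (Some v) = if tri r u v then NT else NZ.
Proof.
case: stepP => [ru ruE|w t|no] /=.
- by case: ifP => // /(duo_tri ru ruE); rewrite eqxx.
- have h3 : has3 w by apply/existsP; exists r; apply/existsP; exists u.
  rewrite h3 andbT; case: eqP => [<-|wv]; first by rewrite t.
  by case: ifP => // /(tri_inj t).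
- case: ifP => // t; move: no; rewrite (tri_subhedge t) orbF.
  by case/and4P: t => /negPf ->.
Qed.

Lemma step2_NP w u v : step (step (NP w) (Some u)) (Some v) = NZ.
Proof. by rewrite /=; case: ifP. Qed.

Lemma step3_NV r u v t : step (step (step (NV r) (Some u)) (Some v)) (Some t) = NZ.
Proof. by rewrite step2_NV; case: ifP. Qed.

Variant edge_spec u : seq V -> Prop :=
| EdgeDuo v of u != v & [set u; v] \in E : edge_spec u [:: v]
| EdgeTri v w of tri u v w : edge_spec u [:: v; w].

Lemma edgeP u s : uniq (u :: s) -> [set:: u :: s] \in E -> edge_spec u s.
Proof.
move=> us eE.
have cs : #|[set:: u :: s]| = (size s).+1 by rewrite cardsE (card_uniqP us).
have := hedges_ge2 eE; have := card_edge eE; rewrite cs.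
case: s us eE {cs} => [|v [|w [|? ?]]] //= us eE _ _.
- apply: EdgeDuo; first by move: us; rewrite !inE andbT.
  by move: eE; rewrite [[set:: _]](_ : _ = [set u; v]) //; apply/setP => t; rewrite !inE.
- apply: EdgeTri; move: us; rewrite !inE negb_or andbT => /andP[/andP[uv uw] vw].
  rewrite /tri uv uw vw /=; move: eE.
  by rewrite [[set:: _]](_ : _ = [set u; v; w]) //; apply/setP => t; rewrite !inE orbA.
Qed.

Lemma run_edge u s : edge_spec u s -> forall n,
  run n (wprod u s) = if n is NE then NT else NZ.
Proof.
case=> [v uv uvE|v w t] [|||r|r] //=; rewrite /run /=.
- by rewrite uv uvE.
- rewrite -[LHS]/(step (step (NV r) (Some u)) (Some v)) step2_NV; case: ifP => //.
  by rewrite tri_sym12 => /(duo_tri uv uvE); rewrite eqxx.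
- by case: ifP.
- by rewrite -[LHS]/(step (step (NV u) (Some v)) (Some w)) step2_NV t.
- by rewrite -[LHS]/(step (step (step (NV r) (Some u)) (Some v)) (Some w)) step3_NV.
- by case: ifP.
Qed.

Lemma linkedP u v r l : linked [set u; v] [set r; l] ->
  [/\ u = v, r = l & u = r] \/ exists w, tri u v w /\ tri r l w.
Proof.
case/and3P => _ _ /existsP[w /and3P[]].
rewrite !inE !negb_or => /andP[/andP[wu wv] /andP[wr wl]] e1 e2.
have deg a b (we : w |: [set a; b] \in E) : w != a -> w != b -> a != b -> tri a b w.
  move=> wa wb ab; rewrite /tri ab (eq_sym b) (eq_sym a) wa wb /=.
  by rewrite setUC.
have dd a b c (h1 : w |: [set a; a] \in E) (h2 : w |: [set b; c] \in E) :
    w != a -> w != b -> w != c -> b = a /\ c = a.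
  move=> wa wb wc; rewrite setUid in h1.
  have e12 : w |: [set b; c] = [set w; a].
    by apply: (duo_isol wa h1 h2 (t := w)); rewrite !inE eqxx.
  have bi : b \in [set w; a] by rewrite -e12 !inE eqxx !orbT.
  have ci : c \in [set w; a] by rewrite -e12 !inE eqxx !orbT.
  move: bi ci; rewrite !inE (eq_sym b w) (eq_sym c w) (negPf wb) (negPf wc) /=.
  by move=> /eqP -> /eqP ->.
have [uv|uv] := eqVneq u v.
  subst v; have [-> ->] := dd _ _ _ e1 e2 wu wr wl; by left.
have [rl|rl] := eqVneq r l.
  by subst l; have [ur vr] := dd _ _ _ e2 e1 wr wu wv; rewrite ur vr eqxx in uv.
by right; exists w; split; apply: deg.
Qed.

Lemma run_pair n u v : run n ('a_u * 'a_v)%W = step (step n (Some u)) (Some v).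
Proof. by []. Qed.

Lemma run_rel x y : sg_rel x y -> forall n, run n x = run n y.
Proof.
case=> {x y}.
- move=> u v [|||r|w]; rewrite !run_pair //.
  + exact: step_sym.
  + by rewrite !step2_NV tri_sym23.
  + by rewrite !step2_NP.
- by move=> u n; rewrite run_mul /run /= stepNone.
- by move=> u n; rewrite run_mul /run /= !stepNone.
- by move=> n; rewrite run_mul /run /= !stepNone.
- move=> u v h n.
  have {}h : (u == v) || ~~ subhyperedge [set u; v].
    by case: h => [->|->]; rewrite ?eqxx ?orbT.
  rewrite run_pair [RHS]/run /= stepNone.
  case: n => [|||r|w] //; last exact: step2_NP.
  + case: stepP => // [uv uvE|w t].
      by move: h; rewrite (negPf uv) (subhedge_edge (set2_neq0 u v) uvE).
    move: h; rewrite (tri_subhedge t) orbF.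
    by case/and4P: t => /negPf ->.
  + rewrite step2_NV; case: ifP => //; rewrite tri_sym12 tri_sym23 => t.
    move: h; rewrite (tri_subhedge t) orbF.
    by case/and4P: t => /negPf ->.
- move=> u v t nE n; rewrite run_mul run_pair [RHS]/run /= stepNone [LHS]/run /=.
  case: n => [|||r|w] //.
  + rewrite -[LHS]/(step (step (NV u) (Some v)) (Some t)) step2_NV.
    by case: ifP => // /tri_edge; rewrite (negPf nE).
  + exact: step3_NV.
  + by rewrite step2_NP.
- move=> u v r l /linkedP[[-> -> ->] //|[w [t1 t2]]] [|||s|s]; rewrite !run_pair //.
  + by rewrite (step_tri t1) (step_tri t2).
  + rewrite !step2_NV; congr (if _ then _ else _).
    rewrite !(tri_sym12 s) !(tri_sym23 _ s).
    by apply/idP/idP => [/(tri_inj t1) <-|/(tri_inj t2) <-].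
  + by rewrite !step2_NP.
- by move=> u s v t us es vt et n; rewrite !run_edge //; apply: edgeP.
Qed.

Lemma run_cong x y : x ~~> y -> forall n, run n x = run n y.
Proof.
elim=> {x y} [x y /run_rel //|//|x y _ IH n|x y z _ IH1 _ IH2 n|x x' y y' _ IH1 _ IH2 n].
- by rewrite IH.
- by rewrite IH1.
- by rewrite !run_mul IH1 IH2.
Qed.

Definition rho (n : nf) : word H :=
  match n with
  | NE | NZ => 0%W
  | NT => if [pick t : V * V * V | tri t.1.1 t.1.2 t.2] is Some t
          then ('a_(t.1.1) * 'a_(t.1.2) * 'a_(t.2))%W else 0%W
  | NV u => ('a_u)%W
  | NP w => if [pick t : V * V | tri t.1 t.2 w] is Some t
            then ('a_(t.1) * 'a_(t.2))%W else 0%W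
  end.

Lemma wmulA : associative (@wmul H).
Proof. by move=> [a s] [b t] [c r]; rewrite /wmul /= -catA. Qed.

Lemma cong_mull x y z : x ~~> y -> x * z ~~> y * z.
Proof. by move=> xy; apply: cong_mul xy (cong_refl _). Qed.

Lemma cong_mulr x y z : x ~~> y -> z * x ~~> z * y.
Proof. by move=> xy; apply: cong_mul (cong_refl _) xy. Qed.

Lemma tri_exists : exists p q r, tri p q r.
Proof.
have [e eE ce] : exists2 e, e \in E & #|e| = 3.
  have n0 : 0 < #|E|.
    rewrite card_gt0; apply/eqP => E0; have := hedges_rank H.
    by rewrite E0 big_set0.
  by have [e eE ce] := eq_bigmax_cond (fun e => #|e|) n0; exists e; rewrite // -ce (hedges_rank H).
have /card_gt0P[p pe] : 0 < #|e| by rewrite ce.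
have c1 : #|e :\ p| = 2 by have := cardsD1 p e; rewrite pe ce => - [].
have /card_gt0P[q qe] : 0 < #|e :\ p| by rewrite c1.
have qp : p != q by move: qe; rewrite !inE eq_sym => /andP[].
have uvs : subhyperedge [set p; q].
  apply: subhedge_edge (set2_neq0 p q) eE _.
  by apply/subsetP => t /set2P[->|->] //; move: qe; rewrite inE => /andP[].
have [pqE|[w t]] := subhedge_pair qp uvs; last by exists p, q, w.
have qe' : q \in e by move: qe; rewrite inE => /andP[].
have epq : e = [set p; q] by apply: (edge_inj eE pqE qp pe qe'); rewrite !inE eqxx ?orbT.
by move: ce; rewrite epq cards2 qp.
Qed.

Lemma cong_edge u s v t : edge_spec u s -> edge_spec v t -> wprod u s ~~> wprod v t.
Proof.
have ok a b : edge_spec a b -> uniq (a :: b) /\ [set:: a :: b] \in E.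
  case=> [c ac acE|c d tt].
    split; first by rewrite /= !inE andbT.
    by rewrite [[set:: _]](_ : _ = [set a; c]) //; apply/setP => z; rewrite !inE.
  case/and4P: (tt) => ac cd ad acdE; split; first by rewrite /= !inE negb_or ac ad cd.
  by rewrite [[set:: _]](_ : _ = [set a; c; d]) //; apply/setP => z; rewrite !inE orbA.
by move=> /ok[h1 h2] /ok[h3 h4]; apply: cong_rel; apply: rel_edge.
Qed.

Lemma cong_rhoT u s : edge_spec u s -> wprod u s ~~> rho NT.
Proof.
move=> es /=; case: pickP => [[[p q] r] /= t|no].
  exact: cong_edge es (EdgeTri t).
by have [p [q [r t]]] := tri_exists; have := no (p, q, r); rewrite /= t.
Qed.

Lemma cong_0gen g : 0 * (g, [::]) ~~> 0.
Proof. by case: g => [u|]; apply: cong_rel; [apply: rel_0gen|apply: rel_00]. Qed.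

Lemma cong_gen0 g : (g, [::]) * 0 ~~> 0.
Proof. by case: g => [u|]; apply: cong_rel; [apply: rel_gen0|apply: rel_00]. Qed.

Lemma word_rcons g s h : (g, rcons s h) = ((g, s) * (h, [::]))%W :> word H.
Proof. by rewrite /wmul /= cats1. Qed.

Lemma cong_mul0 x : x * 0 ~~> 0.
Proof.
case: x => g s; elim/last_ind: s => [|s h IH]; first exact: cong_gen0.
rewrite word_rcons -wmulA; apply: cong_trans IH.
by apply: cong_mulr; apply: cong_gen0.
Qed.

Lemma cong_0mul x : 0 * x ~~> 0.
Proof.
case: x => g s; elim/last_ind: s => [|s h IH]; first exact: cong_0gen.
rewrite word_rcons wmulA; apply: cong_trans (cong_0gen h).
exact: cong_mull.
Qed.

Lemma cong_mulC x y : x * y ~~> y * x.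
Proof.
have gg g h : (g, [::]) * (h, [::]) ~~> (h, [::]) * (g, [::]).
  case: g h => [u|] [v|].
  - by apply: cong_rel; apply: rel_comm.
  - by apply: cong_trans (cong_mul0 _) (cong_sym (cong_0mul _)).
  - by apply: cong_trans (cong_0mul _) (cong_sym (cong_mul0 _)).
  - exact: cong_refl.
have xg z h : z * (h, [::]) ~~> (h, [::]) * z.
  case: z => g s; elim/last_ind: s => [|s k IH]; first exact: gg.
  rewrite word_rcons -wmulA; apply: cong_trans (cong_mulr _ (gg _ _)) _.
  by rewrite !wmulA; apply: cong_mull.
case: y => g s; elim/last_ind: s => [|s k IH]; first exact: xg.
rewrite word_rcons wmulA; apply: cong_trans (cong_mull _ IH) _.
by rewrite -!wmulA; apply: cong_mulr.
Qed.

Lemma cong_sq u : 'a_u * 'a_u ~~> 0.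
Proof. by apply: cong_rel; apply: rel_pair; left. Qed.

Lemma rho_step n g : n <> NE -> rho n * (g, [::]) ~~> rho (step n g).
Proof.
case: g => [v|]; last by rewrite stepNone => _; apply: cong_mul0.
case: n => [|||u|w] // _.
- exact: cong_0mul.
- rewrite /=; case: pickP => [[[p q] r] /= t|_]; last exact: cong_0mul.
  have [->|vr] := eqVneq v r.
    by rewrite -wmulA; apply: cong_trans (cong_mulr _ (cong_sq _)) (cong_mul0 _).
  have nE : [set p; q; v] \notin E.
    case/and4P: (t) => pq qr pr tE; apply/negP => pqvE.
    have e12 : [set p; q; v] = [set p; q; r].
      by apply: (edge_inj pqvE tE pq); rewrite !inE eqxx ?orbT.
    have : r \in [set p; q; v] by rewrite e12 !inE eqxx !orbT.
    by rewrite !inE eq_sym (negPf pr) eq_sym (negPf qr) eq_sym (negPf vr).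
  rewrite -wmulA; apply: cong_trans (cong_mulr _ (cong_mulC _ _)) _.
  rewrite wmulA; apply: cong_trans (cong_mull _ _) (cong_0mul _).
  by apply: cong_rel; apply: rel_triple.
- case: stepP => [uv uvE|w t|no].
  + exact: cong_rhoT (EdgeDuo uv uvE).
  + rewrite /=; case: pickP => [[p q] /= t'|/(_ (u, v))]; last by rewrite /= t.
    apply: cong_rel; apply: rel_linked.
    rewrite /linked (tri_subhedge t) (tri_subhedge t'); apply/existsP; exists w.
    rewrite !inE !negb_or !(setUC [set w]) (tri_edge t) (tri_edge t').
    case/and4P: t => _ vw uw _; case/and4P: t' => _ qw pw _.
    by rewrite !(eq_sym w) vw uw qw pw.
  + by apply: cong_rel; apply: rel_pair; case/orP: no => [/eqP|]; [left|right].
- rewrite /=; case: pickP => [[p q] /= t|no].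
    have -> : has3 w by apply/existsP; exists p; apply/existsP; exists q.
    rewrite andbT; case: eqP => [<-|wv]; first exact: cong_rhoT (EdgeTri t).
    apply: cong_rel; apply: rel_triple; apply/negP => pqvE.
    case/and4P: (t) => pq qw pw tE.
    have e12 : [set p; q; v] = [set p; q; w].
      by apply: (edge_inj pqvE tE pq); rewrite !inE eqxx ?orbT.
    have : w \in [set p; q; v] by rewrite e12 !inE eqxx !orbT.
    by rewrite !inE eq_sym (negPf pw) eq_sym (negPf qw) => /eqP.
  rewrite (_ : has3 w = false) ?andbF; first exact: cong_0mul.
  by apply/existsP => -[p /existsP[q t]]; have := no (p, q); rewrite /= t.
Qed.

Lemma step_NE n g : step n g <> NE.
Proof.
case: g => [v|]; last by rewrite stepNone.
by case: n => [|||u|w] //; [case: stepP|rewrite /=; case: ifP].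
Qed.

Lemma run_NE n x : run n x <> NE.
Proof.
case: x => g s; elim/last_ind: s => [|s h _]; first exact: step_NE.
by rewrite word_rcons run_mul; apply: step_NE.
Qed.

Lemma cong_rho x : x ~~> rho (run NE x).
Proof.
case: x => g s; elim/last_ind: s => [|s h IH].
  by case: g => [u|]; apply: cong_refl.
rewrite word_rcons run_mul; apply: cong_trans (cong_mull _ IH) _.
exact: rho_step (@run_NE _ _).
Qed.

Definition nmul (n m : nf) : nf :=
  match n, m with
  | NV u, NV v => step (NV u) (Some v)
  | NV u, NP w | NP w, NV u => if (w == u) && has3 w then NT else NZ
  | _, _ => NZ
  end.

Lemma run_rho n m : n <> NE -> m <> NE -> run n (rho m) = nmul n m.
Proof.
move=> n0; case: m => [|||v|w] // _.
- rewrite /=; case: pickP => [[[p q] r] /= t|_].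
    case: n n0 => [|||u|w] // _; rewrite run_mul run_pair ?step2_NP //.
    by rewrite step2_NV; case: ifP.
  by rewrite run_w0; case: n n0.
- by case: n n0.
- rewrite /=; case: pickP => [[p q] /= t|no].
    have h3 : has3 w by apply/existsP; exists p; apply/existsP; exists q.
    case: n n0 => [|||u|v] // _; rewrite run_pair ?step2_NP //.
    rewrite step2_NV /nmul h3 andbT tri_sym12 tri_sym23.
    by congr (if _ then _ else _); apply/idP/eqP => [/(tri_inj t)|<-].
  have h3 : has3 w = false.
    by apply/existsP => -[p /existsP[q t]]; have := no (p, q); rewrite /= t.
  by rewrite run_w0; case: n n0 => //= *; rewrite h3 andbF.
Qed.

Lemma nmul_inj n m m' : n <> NE -> m <> NE -> m' <> NE ->
  nmul n m = nmul n m' -> nmul n m <> NZ -> m = m'.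
Proof.
have duo3 u v : u != v -> [set u; v] \in E -> has3 u -> False.
  move=> uv uvE /existsP[p /existsP[q]]; rewrite tri_sym23 tri_sym12.
  by move=> /(duo_tri uv uvE); rewrite eqxx.
move=> n0 m0 m0' e nz; have nz' := nz; rewrite e in nz'.
case: n n0 m0 m0' e nz nz' => [|||u|w] // _.
- case: m m' => [|||v|w] [|||v'|w'] // _ _; rewrite /nmul.
  + case: stepP => [uv uvE|w t|_] //; case: stepP => [uv' uvE'|w' t'|_] // e _ _.
      have e12 : [set u; v] = [set u; v'].
        by apply: (duo_isol uv' uvE' uvE (t := u)); rewrite !inE eqxx.
      have : v \in [set u; v'] by rewrite -e12 !inE eqxx orbT.
      by rewrite !inE eq_sym (negPf uv) => /eqP ->.
    case: e t' => <- t'; rewrite tri_sym23 in t; rewrite tri_sym23 in t'; congr NV.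
    exact: tri_inj t t'.
  + case: stepP => [uv uvE|w t|_] //; case: ifP => // /andP[/eqP -> h3].
    by case: (duo3 _ _ uv uvE h3).
  + case: ifP => // /andP[/eqP -> h3]; case: stepP => // uv uvE.
    by case: (duo3 _ _ uv uvE h3).
  + by case: ifP => // /andP[/eqP -> _]; case: ifP => // /andP[/eqP ->].
- case: m m' => [|||v|v] [|||v'|v'] // _ _; rewrite /nmul.
  by case: ifP => // /andP[/eqP -> _]; case: ifP => // /andP[/eqP ->].
Qed.

Lemma run_NZP x : run NE x = NZ -> x ~~> 0.
Proof. by move=> x0; have := cong_rho x; rewrite x0. Qed.

Lemma cong_cancel x y z : x * y ~~> x * z -> ~ (x * y ~~> 0) -> y ~~> z.
Proof.
move=> xyz xy0.
have r t : run (run NE x) t = nmul (run NE x) (run NE t).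
  by rewrite (run_cong (cong_rho t)) run_rho //; apply: run_NE.
suff yz : run NE y = run NE z.
  by apply: cong_trans (cong_rho y) _; rewrite yz; apply: cong_sym (cong_rho z).
apply: (@nmul_inj (run NE x)); try exact: run_NE.
  by rewrite -!r -!run_mul (run_cong xyz).
by rewrite -r -run_mul => /run_NZP.
Qed.

Lemma sg_pi_eq x y : \pi_(hypergraph_semigroup H) x = \pi_(hypergraph_semigroup H) y <-> x ~~> y.
Proof.
by split=> [/eqmodP/asboolP //|xy]; apply/eqmodP/asboolP.
Qed.

Lemma sg_mulE x y :
  sg_mul (\pi_(hypergraph_semigroup H) x) (\pi_(hypergraph_semigroup H) y) =
  \pi_(hypergraph_semigroup H) (x * y)%W.
Proof.
rewrite /sg_mul; unlock; apply/sg_pi_eq.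
by apply: cong_mul; apply/sg_pi_eq; rewrite reprK.
Qed.

Lemma sg_ind (P : hypergraph_semigroup H -> Prop) :
  (forall x, P (\pi_(hypergraph_semigroup H) x)) -> forall a, P a.
Proof. by move=> h a; rewrite -[a]reprK. Qed.

Lemma sg_mulA : associative (@sg_mul H).
Proof.
elim/sg_ind=> x; elim/sg_ind=> y; elim/sg_ind=> z.
by rewrite !sg_mulE wmulA.
Qed.

Lemma sg_mulC : commutative (@sg_mul H).
Proof.
elim/sg_ind=> x; elim/sg_ind=> y; rewrite !sg_mulE.
by apply/sg_pi_eq; apply: cong_mulC.
Qed.

Lemma sg_0mul (a : hypergraph_semigroup H) : sg_mul (sg0 H) a = sg0 H.
Proof. by elim/sg_ind: a => x; rewrite sg_mulE; apply/sg_pi_eq; apply: cong_0mul. Qed.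

Lemma sg_edge_neq0 u s : uniq (u :: s) -> [set:: u :: s] \in E ->
  \pi_(hypergraph_semigroup H) (wprod u s) <> sg0 H.
Proof.
move=> us eE /sg_pi_eq /run_cong /(_ NE); rewrite run_edge; last exact: edgeP.
by [].
Qed.

Lemma sg_cancel (a b c : hypergraph_semigroup H) :
  sg_mul a b = sg_mul a c -> sg_mul a b <> sg0 H -> b = c.
Proof.
elim/sg_ind: a => x; elim/sg_ind: b => y; elim/sg_ind: c => z.
rewrite !sg_mulE => /sg_pi_eq xyz n0; apply/sg_pi_eq; apply: cong_cancel xyz _.
by move=> /sg_pi_eq.
Qed.

Lemma sg_addC : commutative (@flat_add H).
Proof. by move=> a b; rewrite /flat_add eq_sym; case: eqP => // ->. Qed.

Lemma sg_0add (a : hypergraph_semigroup H) : flat_add (sg0 H) a = sg0 H.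
Proof. by rewrite /flat_add; case: eqP. Qed.

Lemma sg_addA : associative (@flat_add H).
Proof.
move=> a b c; rewrite {2}/flat_add; case: (eqVneq b c) => [<-|bc].
  rewrite {3}/flat_add; case: (eqVneq a b) => [<-|ab]; first by rewrite /flat_add !eqxx.
  by rewrite sg_0add /flat_add (negPf ab).
rewrite sg_addC sg_0add {2}/flat_add; case: (eqVneq a b) => [->|ab].
  by rewrite /flat_add (negPf bc).
by rewrite sg_0add.
Qed.

Lemma sg_mulDr : right_distributive (@sg_mul H) (@flat_add H).
Proof.
move=> a b c; rewrite {1}/flat_add; case: (eqVneq b c) => [<-|bc].
  by rewrite /flat_add eqxx.
rewrite sg_mulC sg_0mul /flat_add; case: eqP => // abc.
apply/eqP; rewrite eq_sym; apply: contraT => /eqP n0.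
by move/eqP: bc => []; apply: sg_cancel abc n0.
Qed.

Lemma sg_mulDl : left_distributive (@sg_mul H) (@flat_add H).
Proof. by move=> a b c; rewrite !(sg_mulC _ c) sg_mulDr. Qed.

Definition hypergraph_semiring : semiring :=
  Semiring (inhabits (sg0 H)) sg_addA sg_addC sg_mulA sg_mulDl sg_mulDr.

End SG.

(* Main.v *)
(** Deleting the 2-element hyperedges of [H] together with their vertices leaves
    a 3-uniform [H'], and S_H' is a subsemiring of S_H.  Conversely, fix a
    hyperedge {p, q, r} of [H'].  In S_H' the elements a_r and a_p a_q multiply to
    a, just as the two generators of a 2-edge do in S_H.  Let I be the set of
    proper 2-colourings of the graph of 2-edges.  In the power of S_H' indexed by
    I, send a vertex of [H'] to the corresponding constant tuple and a vertex v of
    a 2-edge to the tuple equal to a_r or a_p a_q according to the colour of v.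
    There are enough colourings for every product which is 0 in S_H to acquire a
    0 coordinate, so collapsing the tuples having a 0 coordinate gives S_H. *)

From mathcomp Require Import all_boot.
From mathcomp Require Import boolp.
Require Import Defs.

Set Implicit Arguments.
Unset Strict Implicit.
Unset Printing Implicit Defensive.

(** * Generated varieties and their closure under division *)

Lemma variety_is_variety (S : semiring) : is_variety (variety S).
Proof.
split.
- by move=> A B f hf sf VA K HK KS; case: (HK) => q _ _; apply: q hf sf (VA K HK KS).
- by move=> A B f hf sf VA K HK KS; case: (HK) => _ q _; apply: q hf sf (VA K HK KS).
- by move=> I F VF K HK KS; case: (HK) => _ _; apply=> i; apply: VF.
Qed.

Lemma variety_sub (S T : semiring) : variety T S -> forall A, variety S A -> variety T A.
Proof. by move=> TS A; apply=> //; apply: variety_is_variety. Qed.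

Section Divide.
Variables (P B : semiring) (R : P -> B -> Prop).
Hypothesis R_add : forall t s b c, R t b -> R s c -> R (sr_add t s) (sr_add b c).
Hypothesis R_mul : forall t s b c, R t b -> R s c -> R (sr_mul t s) (sr_mul b c).
Hypothesis R_fun : forall t b c, R t b -> R t c -> b = c.
Hypothesis R_surj : forall b, exists t, R t b.

Let car := {p : P * B | R p.1 p.2}.
Let add (p q : car) : car :=
  exist _ (sr_add (sval p).1 (sval q).1, sr_add (sval p).2 (sval q).2)
    (R_add (svalP p) (svalP q)).
Let mul (p q : car) : car :=
  exist _ (sr_mul (sval p).1 (sval q).1, sr_mul (sval p).2 (sval q).2)
    (R_mul (svalP p) (svalP q)).

Let car_inj (p q : car) : (sval p).1 = (sval q).1 -> p = q.
Proof.
case: p q => [[t b] tb] [[s c] sc] /= ts; subst s.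
have bc : b = c := R_fun tb sc; subst c.
by congr exist; apply: Prop_irrelevance.
Qed.

Let car_inhabited : inhabited car.
Proof.
by case: (sr_inhabited B) => b; have [t tb] := R_surj b; apply: inhabits (exist _ (t, b) tb).
Qed.
Let addA : associative add. Proof. by move=> p q r; apply: car_inj; apply: sr_addA. Qed.
Let addC : commutative add. Proof. by move=> p q; apply: car_inj; apply: sr_addC. Qed.
Let mulA : associative mul. Proof. by move=> p q r; apply: car_inj; apply: sr_mulA. Qed.
Let mulDl : left_distributive mul add.
Proof. by move=> p q r; apply: car_inj; apply: sr_mulDl. Qed.
Let mulDr : right_distributive mul add.
Proof. by move=> p q r; apply: car_inj; apply: sr_mulDr. Qed.

(** The graph of [R] is a subsemiring of the product of [P] and [B]. As [R] is functional, the first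
    projection embeds it in [P], and the second maps it onto [B]. *)
Lemma variety_divide (S : semiring) : variety S P -> variety S B.
Proof.
move=> SP; have [quo sub _] := variety_is_variety S.
pose C := Semiring car_inhabited addA addC mulA mulDl mulDr.
apply: (quo C B (fun p => (sval p).2)) => // [b|].
  by have [t tb] := R_surj b; exists (exist _ (t, b) tb).
exact: (sub P C (fun p => (sval p).1)).
Qed.
End Divide.

Notation hsg := hypergraph_semigroup.

(* Sending to 0 every tuple with a zero coordinate turns the image of [phi] in
   the power of the target into a copy of the source. *)
Lemma variety_flat (H H' : hypergraph3) (I : Type) (phi : hsg H -> I -> hsg H') :
  (forall b i, phi b i = sg0 H' -> b = sg0 H) ->
  (forall b c, b <> sg0 H -> c <> sg0 H -> b <> c -> exists i, phi b i <> phi c i) ->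
  (forall b c i, sg_mul b c <> sg0 H ->
     sg_mul (phi b i) (phi c i) = phi (sg_mul b c) i) ->
  (forall b c, sg_mul b c = sg0 H -> exists i, sg_mul (phi b i) (phi c i) = sg0 H') ->
  variety (hypergraph_semiring H') (hypergraph_semiring H).
Proof.
move=> phi0 phi_inj phi_mul phi_mul0.
pose S := hypergraph_semiring H'.
pose R (t : prod_semiring (fun _ : I => S)) (b : hypergraph_semiring H) : Prop :=
  if b == sg0 H then exists i, t i = sg0 H' else t = phi b.
apply: (@variety_divide _ _ R) => [t s b c|t s b c|t b c|b|].
- rewrite /R /=; have [->|b0] := eqVneq b (sg0 H).
    by rewrite sg_0add eqxx => -[i ti] _; exists i; rewrite /= ti; apply: sg_0add.
  have [->|c0] := eqVneq c (sg0 H).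
    by rewrite sg_addC sg_0add eqxx => _ [i si]; exists i; rewrite /= si sg_addC sg_0add.
  move=> -> ->; rewrite {1 4}/flat_add; have [<-|/eqP bc] := eqVneq b c.
    by rewrite (negPf b0); apply: functional_extensionality_dep => i; rewrite /= /flat_add eqxx.
  rewrite eqxx; have [i /eqP ne] := phi_inj _ _ (elimN eqP b0) (elimN eqP c0) bc.
  by exists i; rewrite /= /flat_add (negPf ne).
- rewrite /R /=; have [->|b0] := eqVneq b (sg0 H).
    by rewrite sg_0mul eqxx => -[i ti] _; exists i; rewrite /= ti sg_0mul.
  have [->|c0] := eqVneq c (sg0 H).
    by rewrite sg_mulC sg_0mul eqxx => _ [i si]; exists i; rewrite /= si sg_mulC sg_0mul.
  move=> -> ->; case: eqP => [/phi_mul0 //|bc].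
  by apply: functional_extensionality_dep => i; apply: phi_mul.
- rewrite /R; case: eqP => [->|b0]; case: eqP => [->|c0] //.
  + by move=> [i ti] tc; case: c0; apply: (phi0 c i); rewrite -tc.
  + by move=> tb [i ti]; case: b0; apply: (phi0 b i); rewrite -tb.
  + move=> -> bc; apply: contrapT => /(phi_inj _ _ b0 c0)[i]; apply.
    by rewrite bc.
- rewrite /R; case: eqP => [b0|_]; last by exists (phi b).
  (* Applied to the product of 0 with itself, [phi_mul0] shows that [I] is inhabited, so the
     constant tuple 0 has a zero coordinate. *)
  by have [i _] := phi_mul0 _ _ (sg_0mul (sg0 H)); exists (fun=> sg0 H'), i.
- by have [_ _] := variety_is_variety S; apply=> _ K _.
Qed.

(** * The hypergraph semigroup as the set of valid normal forms under [nmul] *)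

Section NormalForm.
Variable H : hypergraph3.
Implicit Types (n m : nf H) (x y : word H) (u v w : vertex H).

(** The empty word is no element of the semigroup, and [NP w] denotes a product of two generators
    only when some 3-element hyperedge contains [w]. *)
Definition nf_ok n : bool :=
  match n with NE => false | NP w => has3 w | _ => true end.

Lemma tri_has3 u v w : tri u v w -> has3 w.
Proof. by move=> t; apply/existsP; exists u; apply/existsP; exists v. Qed.

Lemma nf_ok_step n g : nf_ok (step n g).
Proof.
case: g => [v|]; last by rewrite stepNone.
case: n => [|||u|w] //; last by rewrite /=; case: ifP.
by case: stepP => // w /tri_has3.
Qed.

Lemma nf_ok_run n x : nf_ok (run n x).
Proof.
case: x => g s; elim/last_ind: s => [|s h _]; first exact: nf_ok_step.
by rewrite word_rcons run_mul; apply: nf_ok_step.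
Qed.

Lemma nmulC n m : nmul n m = nmul m n.
Proof. by case: n m => [|||u|w] [|||v|w'] //; apply: step_sym. Qed.

Lemma run_rhoK n : nf_ok n -> run (NE H) (rho n) = n.
Proof.
case: n => [|||u|w] //=.
  move=> _; case: pickP => [[[p q] r] /= t|no].
    by rewrite -(run_edge (EdgeTri t) (NE H)).
  by have [p [q [r t]]] := tri_exists H; have := no (p, q, r); rewrite /= t.
move=> /existsP[p /existsP[q t]]; case: pickP => [[p' q'] /= t'|/(_ (p, q))].
  by rewrite run_pair; apply: step_tri.
by rewrite /= t.
Qed.

Definition nf_val (b : hsg H) : nf H := run (NE H) (repr b).
Definition of_nf n : hsg H := (\pi_(hsg H) (rho n))%qT.

Lemma nf_val_ok b : nf_ok (nf_val b).
Proof. exact: nf_ok_run. Qed.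

Lemma nf_valK : cancel nf_val of_nf.
Proof.
move=> b; rewrite -[RHS]reprK; apply/sg_pi_eq/cong_sym.
exact: cong_rho.
Qed.

Lemma nf_val_pi x : nf_val (\pi_(hsg H) x)%qT = run (NE H) x.
Proof. by apply: run_cong; apply/sg_pi_eq; rewrite reprK. Qed.

Lemma of_nfK n : nf_ok n -> nf_val (of_nf n) = n.
Proof. by move=> nok; rewrite nf_val_pi run_rhoK. Qed.

Lemma nf_val_mul (b c : hsg H) : nf_val (sg_mul b c) = nmul (nf_val b) (nf_val c).
Proof.
rewrite -[b in LHS]reprK -[c in LHS]reprK sg_mulE nf_val_pi run_mul.
rewrite (run_cong (cong_rho (repr c))) run_rho //; exact: run_NE.
Qed.

Lemma nf_val0 b : nf_val b = NZ H <-> b = sg0 H.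
Proof.
split=> [b0|->]; first by rewrite -[b]nf_valK b0.
by rewrite nf_val_pi run_w0.
Qed.

End NormalForm.

(** The criterion of [variety_flat] carried along the bijection [nf_val], so that it can be checked
    by cases on normal forms. *)
Lemma variety_nf (H H' : hypergraph3) (I : Type) (phi : nf H -> I -> nf H') :
  (forall n i, nf_ok n -> nf_ok (phi n i)) ->
  (forall n i, nf_ok n -> phi n i = NZ H' -> n = NZ H) ->
  (forall n m, nf_ok n -> nf_ok m -> n <> NZ H -> m <> NZ H -> n <> m ->
     exists i, phi n i <> phi m i) ->
  (forall n m i, nf_ok n -> nf_ok m -> nmul n m <> NZ H ->
     nmul (phi n i) (phi m i) = phi (nmul n m) i) ->
  (forall n m, nf_ok n -> nf_ok m -> nmul n m = NZ H ->
     exists i, nmul (phi n i) (phi m i) = NZ H') ->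
  variety (hypergraph_semiring H') (hypergraph_semiring H).
Proof.
move=> phi_ok phi0 phi_inj phi_mul phi_mul0.
have ok := @nf_val_ok H.
have inj (K : hypergraph3) : injective (@nf_val K) := can_inj (@nf_valK K).
apply: (@variety_flat H H' I (fun b i => of_nf (phi (nf_val b) i))).
- move=> b i /nf_val0; rewrite of_nfK ?phi_ok // => /phi0 b0.
  by apply/nf_val0; apply: b0.
- move=> b c b0 c0 bc.
  have [|||i ne] := @phi_inj _ _ (ok b) (ok c); first by move/nf_val0.
  + by move/nf_val0.
  + by move/inj.
  exists i => e; apply: ne.
  by rewrite -[LHS]of_nfK ?phi_ok // e of_nfK ?phi_ok.
- move=> b c i bc; apply: inj; rewrite nf_val_mul !of_nfK ?phi_ok //.
  by rewrite nf_val_mul phi_mul // -nf_val_mul => /nf_val0.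
- move=> b c /nf_val0; rewrite nf_val_mul => /phi_mul0[//|//|i e].
  by exists i; apply/nf_val0; rewrite nf_val_mul !of_nfK ?phi_ok.
Qed.

(** * The 3-uniform part of a hypergraph *)

Section UniformPart.
Variable H : hypergraph3.
Local Notation V := (vertex H).
Implicit Types (u v w : V).

Lemma tri_has3l u v w : tri u v w -> has3 u.
Proof. by rewrite tri_sym12 tri_sym23; apply: tri_has3. Qed.

Lemma tri_has3m u v w : tri u v w -> has3 v.
Proof. by rewrite tri_sym23; apply: tri_has3. Qed.

Lemma has3_tri w : has3 w -> exists p q, tri w p q.
Proof.
case/existsP=> p /existsP[q]; rewrite tri_sym23 tri_sym12 => t.
by exists p, q.
Qed.

Definition duo u v : bool := (u != v) && ([set u; v] \in hedges H).

Lemma duoC u v : duo u v = duo v u.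
Proof. by rewrite /duo eq_sym setUC. Qed.

Lemma duo_has3 u v : duo u v -> ~~ has3 u.
Proof.
case/andP=> uv uvE; apply/negP => /has3_tri[p [q t]].
by have := duo_tri uv uvE t; rewrite eqxx.
Qed.

(** By isolation, the 2-edges form a matching. *)
Lemma duo_inj u v w : duo u v -> duo u w -> v = w.
Proof.
case/andP=> uv uvE /andP[uw uwE].
have e : [set u; v] = [set u; w] by apply: (duo_isol uw uwE uvE (t := u)); rewrite !inE eqxx.
have : v \in [set u; w] by rewrite -e !inE eqxx orbT.
by rewrite !inE eq_sym (negPf uv) => /eqP.
Qed.

(** By covering and isolation, these are exactly the vertices lying on no 2-edge. *)
Definition vertex3 : finType := {u : V | has3 u}.
Definition hedges3 : {set {set vertex3}} :=
  [set e : {set vertex3} | val @: e \in hedges H].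

(** A hyperedge of two elements would be isolated, whereas its vertices lie in 3-element
    hyperedges. *)
Lemma hedges3_card e : e \in hedges3 -> #|e| = 3.
Proof.
rewrite inE => eE; have := card_edge eE; have := hedges_ge2 eE.
rewrite card_imset; last exact: val_inj.
rewrite leq_eqVlt => /orP[|ge3 le3]; last by apply/eqP; rewrite eqn_leq le3.
rewrite eq_sym => /cards2P[u [v [uv euv]]] _; move: eE.
rewrite euv imsetU1 imset_set1 => eE.
have /duo_has3 : duo (val u) (val v) by rewrite /duo eE andbT val_eqE.
by rewrite (valP u).
Qed.

Lemma tri_hedges3 (u v w : vertex3) :
  tri (val u) (val v) (val w) -> [set u; v; w] \in hedges3.
Proof. by move=> /tri_edge t; rewrite inE !imsetU !imset_set1. Qed.

Lemma hedges3_rank : \max_(e in hedges3) #|e| = 3.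
Proof.
apply/eqP; rewrite eqn_leq; apply/andP; split.
  by apply/bigmax_leqP => e /hedges3_card ->.
have [p [q [r t]]] := tri_exists H.
have t3 := @tri_hedges3 (Sub p (tri_has3l t)) (Sub q (tri_has3m t)) (Sub r (tri_has3 t)) t.
by rewrite -{1}(hedges3_card t3); apply: leq_bigmax_cond.
Qed.

Lemma hedges3_linear (e f : {set vertex3}) :
  e \in hedges3 -> f \in hedges3 -> e != f -> #|e :&: f| <= 1.
Proof.
rewrite !inE => eE fE ef.
rewrite -(card_imset _ val_inj) imsetI; last by move=> ? ? _ _; apply: val_inj.
by apply: hedges_linear => //; rewrite (inj_eq (imset_inj val_inj)).
Qed.

Lemma hedges3_cover (u : vertex3) : exists2 e, e \in hedges3 & u \in e.
Proof.
have [p [q t]] := has3_tri (valP u).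
have t3 := @tri_hedges3 u (Sub p (tri_has3m t)) (Sub q (tri_has3 t)) t.
by eexists; [exact: t3|rewrite !inE eqxx].
Qed.

Lemma hedges3_ge2 (e : {set vertex3}) : e \in hedges3 -> 2 <= #|e|.
Proof. by move/hedges3_card ->. Qed.

Lemma hedges3_isol2 (e f : {set vertex3}) :
  e \in hedges3 -> f \in hedges3 -> #|e| = 2 -> f != e -> [disjoint e & f].
Proof. by move/hedges3_card ->. Qed.

Definition uniform_part : hypergraph3 :=
  Hypergraph3 hedges3_rank hedges3_linear hedges3_cover hedges3_ge2 hedges3_isol2.
Local Notation H3 := uniform_part.
Local Notation V3 := (vertex H3).

Lemma tri3E (u v w : V3) : tri u v w = tri (val u) (val v) (val w).
Proof. by rewrite /tri !val_eqE /= !inE !imsetU !imset_set1. Qed.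

Lemma has3_uniform (u : V3) : has3 u.
Proof.
have [p [q]] := has3_tri (valP u); rewrite tri_sym12 tri_sym23 => t.
apply/existsP; exists (Sub p (tri_has3l t)).
by apply/existsP; exists (Sub q (tri_has3m t)); rewrite tri3E.
Qed.

(** * The semiring of the uniform part as a subsemiring *)

Definition nf_emb (n : nf H3) : nf H :=
  match n with
  | NE => NE H | NZ => NZ H | NT => NT H | NV u => NV (val u) | NP w => NP (val w)
  end.

Lemma nf_emb_ok n : nf_ok n -> nf_ok (nf_emb n).
Proof. by case: n => //= w _; apply: valP. Qed.

Lemma nf_emb_inj : injective nf_emb.
Proof. by move=> [|||u|w] [|||v|w'] //= [] /val_inj ->. Qed.

Lemma step_emb (u v : V3) :
  step (NV (val u)) (Some (val v)) = nf_emb (step (NV u) (Some v)).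
Proof.
have nd : ~~ duo (val u) (val v) by apply/negP => /duo_has3; rewrite (valP u).
case: (stepP u v) => [uv uvE|w|no].
- by have := hedges3_card uvE; rewrite cards2 uv.
- by rewrite tri3E; apply: step_tri.
case: stepP => // [uv uvE|w t]; first by move: nd; rewrite /duo uv uvE.
(* The third vertex of the hyperedge survives too, so the hyperedge is already one of the uniform
   part. *)
have t3 : tri u v (Sub w (tri_has3 t) : V3) by rewrite tri3E.
case/orP: no => [uv|]; last by rewrite (tri_subhedge t3).
by case/and4P: t3; rewrite uv.
Qed.

Lemma nmul_emb n m : nmul (nf_emb n) (nf_emb m) = nf_emb (nmul n m).
Proof.
by case: n m => [|||u|w] [|||v|w'] //=; rewrite ?has3_uniform ?(valP w) ?(valP w') ?andbT;
  rewrite ?val_eqE; try (by case: ifP); apply: step_emb.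
Qed.

(** With a one-point index set the criterion only asks for an injective map that preserves products
    and 0, namely [nf_emb]. *)
Lemma variety_uniform_part :
  variety (hypergraph_semiring H) (hypergraph_semiring H3).
Proof.
apply: (@variety_nf _ _ unit (fun n _ => nf_emb n)).
- by move=> n _; apply: nf_emb_ok.
- by move=> n _ _ n0; apply: nf_emb_inj.
- by move=> n m _ _ _ _ nm; exists tt => /nf_emb_inj.
- by move=> n m _ _ _ _; apply: nmul_emb.
- by move=> n m _ _ nm0; exists tt; rewrite nmul_emb nm0.
Qed.

(** * Proper 2-colourings of the 2-edges *)

Definition colouring := {f : V -> bool | forall u v, duo u v -> f v = ~~ f u}.

(** In a matching, components have at most two vertices and are coloured independently, so two
    prescribed colours can clash only within one component. *)
Lemma ex_colouring u v b c : (u = v -> c = b) -> (duo u v -> c = ~~ b) ->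
  exists f : colouring, sval f u = b /\ sval f v = c.
Proof.
move=> ubc dbc.
(* Lying in the same component of the matching. *)
pose same x y := (x == y) || duo x y.
have same_duo x y z : duo y z -> same x y -> same x z.
  rewrite /same => yz /orP[/eqP -> |]; first by rewrite yz orbT.
  by rewrite duoC => yx; rewrite (duo_inj yx yz) eqxx.
have sameE x y z : duo y z -> same x y = same x z.
  by move=> yz; apply/idP/idP; apply: same_duo; rewrite // duoC.
(* A reference colouring: on each 2-edge the endpoint enumerated first gets [true]. *)
pose f0 x := [exists y, duo x y && (enum_rank x < enum_rank y)].
have f0E x y : duo x y -> f0 x = (enum_rank x < enum_rank y).
  move=> xy; apply/existsP/idP => [[z /andP[xz]]|]; first by rewrite (duo_inj xy xz).
  by exists y; rewrite xy.
have f0_duo x y : duo x y -> f0 y = ~~ f0 x.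
  move=> xy; rewrite (f0E _ _ xy) (f0E y x) 1?duoC // -leqNgt ltn_neqAle andb_idl //.
  move=> _; apply/negP => /eqP /val_inj /enum_rank_inj yx.
  by case/andP: xy; rewrite yx eqxx.
(* Flip [f0] on the component of [u] if it is wrong at [u], and on that of [v], when different, if
   it is wrong at [v]. *)
pose f x := f0 x (+) (same u x && (f0 u (+) b))
                 (+) [&& same v x, ~~ same u v & f0 v (+) c].
have f_duo x y : duo x y -> f y = ~~ f x.
  by move=> xy; rewrite /f -!(sameE _ _ _ xy) (f0_duo _ _ xy) !addNb.
exists (exist _ f f_duo); rewrite /= /f; split.
  have -> : same v u = same u v by rewrite /same eq_sym duoC.
  rewrite {1}/same eqxx /= -addbA; case: (same u v) => /=;
    by case: (f0 u) b {ubc dbc f f_duo} => -[].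
rewrite {2}/same eqxx /=; case: (boolP (same u v)) => [|_] /=.
  case/orP => [/eqP uv|uv]; first by
    rewrite (ubc uv) -uv; case: (f0 u) b {ubc dbc f f_duo} => -[].
  by rewrite (dbc uv) (f0_duo _ _ uv); case: (f0 u) b {ubc dbc f f_duo} => -[].
by case: (f0 v) c {ubc dbc f f_duo} => -[].
Qed.

(** * Recovering the whole semiring from a power of that of the uniform part *)

Section Power.
Variable r : V3.

(* The vertices of a 2-edge are sent to [a_r] and to the product [a_p a_q] with
   [{p, q, r}] a hyperedge, in the order told by the colouring. *)
Definition nf_pow (n : nf H) (f : colouring) : nf H3 :=
  match n with
  | NE => NE H3 | NZ => NZ H3 | NT => NT H3
  | NV u => if insub u is Some u' then NV (u' : V3)
            else if sval f u then NV r else NP r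
  | NP w => if insub w is Some w' then NP (w' : V3) else NZ H3
  end.

Lemma nf_powK n f : nf_pow (nf_emb n) f = n.
Proof. by case: n => //= u; rewrite valK. Qed.

Lemma nf_pow2 u f : ~~ has3 u -> nf_pow (NV u) f = if sval f u then NV r else NP r.
Proof. by move=> u2; rewrite /= insubN. Qed.

(** Validity excludes [NP w] for [w] on a 2-edge, so only the generators of 2-edge vertices escape
    the image of [nf_emb]. *)
Lemma nf_okP n : nf_ok n ->
  (exists2 n', nf_ok n' & n = nf_emb n') \/ (exists2 u, ~~ has3 u & n = NV u).
Proof.
case: n => [|||u|w] //= nok; try (left; first [by exists (NZ H3)|by exists (NT H3)]).
  case: (boolP (has3 u)) => u3; last by right; exists u.
  by left; exists (NV (Sub u u3 : V3)).
by left; exists (NP (Sub w nok : V3)) => //; apply: has3_uniform.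
Qed.

(** No hyperedge contains both a vertex of a 2-edge and a vertex of the uniform part. *)
Lemma nmul_emb2 n u : ~~ has3 u -> nmul (nf_emb n) (NV u) = NZ H.
Proof.
move=> u2; case: n => [|||v|w] //.
  rewrite /nmul /nf_emb; case: stepP => // [vu vuE|w /tri_has3m]; last by rewrite (negPf u2).
  have /duo_has3 : duo (val v) u by rewrite /duo vu.
  by rewrite (valP v).
rewrite /=; case: eqP => // wu; by rewrite -wu (valP w) in u2.
Qed.

Lemma nmul_sq (K : hypergraph3) (u : vertex K) : nmul (NV u) (NV u) = NZ K.
Proof. by rewrite /nmul; case: stepP => // [|w]; rewrite /tri eqxx. Qed.

Lemma variety_power : variety (hypergraph_semiring H3) (hypergraph_semiring H).
Proof.
have col u b : exists f : colouring, sval f u = b.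
  have [//|/andP[]|f [fu _]] := @ex_colouring u u b b; first by rewrite eqxx.
  by exists f.
have emb2_neq n u : ~~ has3 u -> exists f, n <> nf_pow (NV u) f.
  (* The colour makes the image of [u] a generator when [n] is a pair value, and a pair value
     otherwise. *)
  move=> u2; have [f fu] := col u (if n is NP _ then true else false).
  by exists f; rewrite nf_pow2 // fu; case: n fu.
have emb2_mul n u : ~~ has3 u -> exists f, nmul n (nf_pow (NV u) f) = NZ H3.
  (* Only [NV r] has a nonzero product with [NP r]; for it the image [NV r] is chosen instead,
     because squares of generators vanish. *)
  move=> u2; have [f fu] := col u (if n is NV v then v == r else false).
  exists f; rewrite nf_pow2 // fu {f fu}; case: n => // v.
  by case: eqVneq => [->|vr]; [apply: nmul_sq|rewrite /= eq_sym (negPf vr)].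
apply: (@variety_nf _ _ colouring nf_pow).
- move=> n f /nf_okP[[n' ok ->]|[u u2 ->]]; first by rewrite nf_powK.
  by rewrite nf_pow2 //; case: ifP => // _; apply: has3_uniform.
- move=> n f /nf_okP[[n' ok ->]|[u u2 ->]]; first by rewrite nf_powK => ->.
  by rewrite nf_pow2 //; case: ifP.
- move=> n m /nf_okP[[n' okn ->]|[u u2 ->]] /nf_okP[[m' okm ->]|[v v2 ->]] _ _ nm.
  + have [f _] := col (val r) true; exists f; rewrite !nf_powK => e.
    by rewrite e in nm.
  + by have [f ne] := emb2_neq n' v v2; exists f; rewrite nf_powK.
  + have [f ne] := emb2_neq m' u u2; exists f; rewrite nf_powK => e.
    exact: ne.
  (* Opposite colours are admissible for distinct vertices, adjacent or not. *)
  + have [uv||f [fu fv]] := @ex_colouring u v true false => //.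
      by case: nm; rewrite uv.
    by exists f; rewrite !nf_pow2 // fu fv.
- move=> n m f /nf_okP[[n' okn ->]|[u u2 ->]] /nf_okP[[m' okm ->]|[v v2 ->]].
  + by rewrite nmul_emb !nf_powK.
  + by rewrite nmul_emb2.
  + by rewrite nmulC nmul_emb2.
  + rewrite !nf_pow2 // [nmul (NV u) _]/nmul; case: stepP => // [uv uvE|w /tri_has3l].
      have d : duo u v by rewrite /duo uv.
      rewrite (svalP f _ _ d) => _.
      (* The two ends of a 2-edge have opposite colours, so the factors are [NV r] and [NP r] in
         some order, with product [NT]. *)
      by case: (sval f u); rewrite /= eqxx has3_uniform.
    by rewrite (negPf u2).
- move=> n m /nf_okP[[n' okn ->]|[u u2 ->]] /nf_okP[[m' okm ->]|[v v2 ->]].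
  + have [f _] := col (val r) true; rewrite nmul_emb => nm0; exists f.
    by rewrite !nf_powK; apply: nf_emb_inj.
  + by have [f e] := emb2_mul n' v v2; exists f; rewrite nf_powK.
  + by have [f e] := emb2_mul m' u u2; exists f; rewrite nf_powK nmulC.
  (* A zero product means that [u] and [v] span no 2-edge, so both may be sent to [NV r], whose
     square is 0. *)
  + move=> uv0; have [//|d|f [fu fv]] := @ex_colouring u v true true.
      by move: uv0; case/andP: d => uv uvE; rewrite /= uv uvE.
    by exists f; rewrite !nf_pow2 // fu fv nmul_sq.
Qed.
End Power.
End UniformPart.

Theorem lemma2p5 (H : hypergraph3) :
  exists H' : hypergraph3,
    uniform3 H' /\
    (forall A : semiring,
      variety (hypergraph_semiring H) A <-> variety (hypergraph_semiring H') A).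
Proof.
exists (uniform_part H); split=> [e|A]; first exact: hedges3_card.
have [p [q [r t]]] := tri_exists H.
split; apply: variety_sub; last exact: variety_uniform_part.
exact: (variety_power (Sub r (tri_has3 t))).
Qed.
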